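(* Let $\mathcal{A}$ be an association scheme on $q\geq 3$ vertices. Then, for every integer $n\geq 2$, the Bose-Mesner algebra of the generalized Hamming scheme $\mathcal{H}(n,\mathcal{A})$ is not the Nomura algebra of a type II matrix; that is, there is no type II matrix $W$ (of size $q^n\times q^n$) such that $\mathcal{N}_W$ equals the Bose-Mesner algebra of $\mathcal{H}(n,\mathcal{A})$.
   Context: All matrices are over $\mathbb{C}$; $I$ and $J$ denote the identity and all-ones matrices, and $\otimes$ is the Kronecker product. An association scheme on $q$ vertices (elements) with $d$ classes is a set of $q\times q$ $01$-matrices $\mathcal{A}=\{A_0,\ldots,A_d\}$ such that (i) $A_0=I$; (ii) $\sum_{i=0}^d A_i=J$; (iii) $A_i^T\in\mathcal{A}$ for all $i$; (iv) $A_iA_j$ lies in the span of $\mathcal{A}$ for all $i,j$; (v) $A_iA_j=A_jA_i$ for all $i,j$. The complex span of $\mathcal{A}$ is its Bose-Mesner algebra. Generalized Hamming scheme: let $\mathcal{A}^{\otimes n}=\{A_{i_1}\otimes\cdots\otimes A_{i_n}: 0\le i_1,\ldots,i_n\le d\}$ be the product association scheme on $q^n$ vertices. The symmetric group $\mathcal{S}_n$ acts on the span of $\mathcal{A}^{\otimes n}$ by linear extension of $(A_{i_1}\otimes\cdots\otimes A_{i_n})^\sigma=A_{i_{1\sigma^{-1}}}\otimes\cdots\otimes A_{i_{n\sigma^{-1}}}$. The set of matrices in the span of $\mathcal{A}^{\otimes n}$ fixed by every $\sigma\in\mathcal{S}_n$ is the Bose-Mesner algebra of a subscheme of $\mathcal{A}^{\otimes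 n}$, and this subscheme is the generalized Hamming scheme $\mathcal{H}(n,\mathcal{A})$. A $v\times v$ matrix $W$ with no zero entries is a type II matrix if $\sum_{x=1}^v \frac{W(x,a)}{W(x,b)}=\delta_{a,b}v$ for all $a,b=1,\ldots,v$. For such $W$ and $a,b\in\{1,\ldots,v\}$, let $Y_{a,b}\in\mathbb{C}^v$ be the vector with entries $Y_{a,b}(x)=W(x,a)/W(x,b)$. The Nomura algebra $\mathcal{N}_W$ is the set of all $v\times v$ complex matrices $M$ such that every $Y_{a,b}$ is an eigenvector of $M$. *)

(* Defs.v *)
From HB Require Import structures.
From mathcomp Require Import all_boot all_order all_algebra all_fingroup.
From mathcomp Require Import mxtens complex reals.

Set Implicit Arguments.
Unset Strict Implicit.
Unset Printing Implicit Defensive.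

Import Order.TTheory GRing.Theory Num.Theory.

Local Open Scope ring_scope.

Definition mxspan (K : fieldType) (I : finType) (N : nat) (B : I -> 'M[K]_N) :
    {vspace 'M[K]_N} :=
  <<[seq B i | i : I]>>%VS.

(* A scheme with d classes is the indexed family A_0, ..., A_d; injectivity
   says that these are d + 1 distinct members of the underlying set. *)
Record is_assoc_scheme (K : fieldType) (q d : nat) (A : 'I_d.+1 -> 'M[K]_q) :
    Prop := IsAssocScheme {
  scheme_inj : injective A;
  scheme_01 : forall i x y, A i x y = 0 \/ A i x y = 1;
  scheme_id : A ord0 = 1%:M;
  scheme_sum : \sum_i A i = const_mx 1;
  scheme_tr : forall i, exists j, (A i)^T = A j;
  scheme_mul : forall i j, A i *m A j \in mxspan A;
  scheme_comm : forall i j, A i *m A j = A j *m A i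
}.

(* B_0 *t (B_1 *t (... *t (B_(n-1) *t 1%:M))), the innermost factor being the
   1 x 1 identity. *)
Fixpoint kron (K : fieldType) (q n : nat) : ('I_n -> 'M[K]_q) -> 'M[K]_(q ^ n) :=
  match n return ('I_n -> 'M[K]_q) -> 'M[K]_(q ^ n) with
  | 0 => fun=> 1%:M
  | m.+1 => fun B =>
      castmx (esym (expnS q m), esym (expnS q m))
             (B ord0 *t kron (fun k => B (lift ord0 k)))
  end.

Definition prod_scheme (K : fieldType) (q d n : nat) (A : 'I_d.+1 -> 'M[K]_q)
    (i : {ffun 'I_n -> 'I_d.+1}) : 'M[K]_(q ^ n) :=
  kron (fun k => A (i k)).

(* f is a linear map with f (A_i) = (A_i)^s on the product scheme. Its
   restriction to the span is the action of s: it exists by tensor_action_ex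
   and is unique by tensor_action_uniq. *)
Definition is_tensor_action (K : fieldType) (q d n : nat)
    (A : 'I_d.+1 -> 'M[K]_q) (s : 'S_n) (f : 'End('M[K]_(q ^ n))) : Prop :=
  forall i : {ffun 'I_n -> 'I_d.+1},
    f (prod_scheme A i) = prod_scheme A [ffun k => i ((s^-1)%g k)].

(* Membership in the Bose-Mesner algebra of H(n, A). *)
Definition gen_hamming_BM (K : fieldType) (q d n : nat)
    (A : 'I_d.+1 -> 'M[K]_q) (M : 'M[K]_(q ^ n)) : Prop :=
  M \in mxspan (prod_scheme (n := n) A) /\
  forall (s : 'S_n) (f : 'End('M[K]_(q ^ n))), is_tensor_action A s f -> f M = M.

Definition is_typeII (K : fieldType) (v : nat) (W : 'M[K]_v) : Prop :=
  (forall x a, W x a != 0) /\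
  (forall a b, \sum_x W x a / W x b = (a == b)%:R * v%:R).

Definition nomura_vec (K : fieldType) (v : nat) (W : 'M[K]_v) (a b : 'I_v) :
    'cV[K]_v :=
  \col_x (W x a / W x b).

Definition is_eigenvector (K : fieldType) (v : nat) (M : 'M[K]_v)
    (y : 'cV[K]_v) : Prop :=
  y != 0 /\ exists c : K, M *m y = c *: y.

Definition nomura (K : fieldType) (v : nat) (W : 'M[K]_v) (M : 'M[K]_v) : Prop :=
  forall a b, is_eigenvector M (nomura_vec W a b).

Fixpoint digit (q n : nat) : 'I_(q ^ n) -> 'I_n -> 'I_q :=
  match n return 'I_(q ^ n) -> 'I_n -> 'I_q with
  | 0 => fun _ k => False_rect _ (notF (ltn_ord k))
  | m.+1 => fun x k =>
      let u := mxtens_unindex (cast_ord (expnS q m) x) in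
      if unlift ord0 k is Some j then digit u.2 j else u.1
  end.

Lemma digit_ord0 (q n : nat) (x : 'I_(q ^ n.+1)) :
  digit x ord0 = (mxtens_unindex (cast_ord (expnS q n) x)).1.
Proof. by rewrite /= unlift_none. Qed.

Lemma digit_lift (q n : nat) (x : 'I_(q ^ n.+1)) (j : 'I_n) :
  digit x (lift ord0 j) = digit (mxtens_unindex (cast_ord (expnS q n) x)).2 j.
Proof. by rewrite /= liftK. Qed.

Lemma kronE (K : fieldType) (q n : nat) (B : 'I_n -> 'M[K]_q) x y :
  kron B x y = \prod_k B k (digit x k) (digit y k).
Proof.
elim: n B x y => [|n IHn] B x y.
  by rewrite big_ord0 /= (_ : x = y) ?mxE ?eqxx //; exact: (etrans (@ord1 x) (esym (@ord1 y))).
rewrite big_ord_recl /= castmxE !esymK mxE IHn /= unlift_none.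
by congr (_ * _); apply: eq_bigr => k _; rewrite liftK.
Qed.

Lemma digit_inj (q n : nat) (x y : 'I_(q ^ n)) : digit x =1 digit y -> x = y.
Proof.
elim: n x y => [|n IHn] x y e; first exact: (etrans (@ord1 x) (esym (@ord1 y))).
apply: (@cast_ord_inj _ _ (expnS q n)); apply: (can_inj (@mxtens_unindexK _ _)).
have e0 := e ord0; rewrite !digit_ord0 in e0.
have eS : (mxtens_unindex (cast_ord (expnS q n) x)).2 =
          (mxtens_unindex (cast_ord (expnS q n) y)).2.
  by apply: IHn => j; rewrite -!digit_lift.
exact: (congr2 pair e0 eS).
Qed.

Lemma digit_surj (q n : nat) (g : 'I_n -> 'I_q) :
  exists x : 'I_(q ^ n), digit x =1 g.
Proof.
elim: n g => [|n IHn] g; first by exists (ord0 : 'I_1); case.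
have [x xP] := IHn (fun j => g (lift ord0 j)).
exists (cast_ord (esym (expnS q n)) (mxtens_index (g ord0, x))) => k.
case: (unliftP ord0 k) => [j ->|->].
  by rewrite digit_lift cast_ordKV mxtens_indexK xP.
by rewrite digit_ord0 cast_ordKV mxtens_indexK.
Qed.

Lemma tensor_action_ex (K : fieldType) (q d n : nat) (A : 'I_d.+1 -> 'M[K]_q)
  (s : 'S_n) : exists f, is_tensor_action A s f.
Proof.
have p x : exists y : 'I_(q ^ n), [forall k, digit y k == digit x (s k)].
  by have [y yP] := digit_surj (fun k => digit x (s k)); exists y;
     apply/forallP => k; rewrite yP.
pose h x := xchoose (p x).
have hP x k : digit (h x) k = digit x (s k).
  exact/eqP/(forallP (xchooseP (p x)) k).
exists (linfun (mxsub h h)) => i; rewrite lfunE /=.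
apply/matrixP => x y; rewrite mxE !kronE.
rewrite [RHS](reindex_inj (@perm_inj _ s)); apply: eq_bigr => k _.
by rewrite ffunE permK !hP.
Qed.

Lemma tensor_action_uniq (K : fieldType) (q d n : nat)
  (A : 'I_d.+1 -> 'M[K]_q) (s : 'S_n) f g M :
  is_tensor_action A s f -> is_tensor_action A s g ->
  M \in mxspan (prod_scheme (n := n) A) -> f M = g M.
Proof.
move=> fP gP MX; rewrite (coord_span (X := in_tuple _) MX) !linear_sum /=.
apply: eq_bigr => k _; rewrite !linearZ /=; congr (_ *: _).
have /mapP[i _ ->] := mem_nth 0 (ltn_ord k).
by rewrite fP gP.
Qed.

(* Main.v *)
Require Import Defs.
From mathcomp Require Import all_boot all_order all_algebra.
From mathcomp Require Import fingroup perm complex boolp reals ring.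

(** The identity and the all-ones matrix lie in the span of any scheme on q
    points, so the Bose-Mesner algebra of H(n, A) contains two symmetric
    matrices that depend on n and q only, indexed by words x, z of length n:
    S(x, z), the number of coordinates where x and z agree, and D, the sum over
    k of the matrix L_k that relates two words agreeing outside coordinate k.
    Suppose that a type II matrix W has every ratio vector
    Y_ab = W(-, a) / W(-, b) as an eigenvector of S and of D.  Then every Y_ab
    is an eigenvector of each single L_k.  But L_k is not invariant under
    permutations of the coordinates, so for n >= 2 the Nomura algebra of W is
    strictly larger than the algebra of H(n, A).

    Call a function of words a coordinate sum if it is f_1(x_1)+...+f_n(x_n).
    The image of S consists of coordinate sums and, S being symmetric, its
    kernel is orthogonal to them.  Hence Y_ab is either a coordinate
    sum (nonzero eigenvalue; call a and b adjacent) or has zero sum over every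
    fibre x_k = c ([ratio_coord_sum], [ratio_fibre_sum0]).  Adjacency is
    symmetric, because transposing a matrix of the Nomura algebra transposes
    its table of eigenvalues ([eigenvalue_transpose]).  So for adjacent a, b
    both Y_ab and its inverse Y_ba are coordinate sums.

    A coordinate sum whose inverse is also one depends on one coordinate only,
    or equals F(x_k) + G(x_l) with F and G each taking two opposite values
    ([coord_sum_inv_cases]).  The second shape cannot occur when q >= 3
    ([two_coord_false]): then F(e) = F(e') for some e <> e', and comparing
    Y_ac with Y_bc = Y_ac / Y_ab shows that no Y_ac with c adjacent to a
    distinguishes e from e' at coordinate k; but these Y_ac span all coordinate
    sums, among them the indicator of x_k = e.

    Thus Y_ab depends on a single coordinate for adjacent a, b.  The adjacency
    graph is connected because coordinate sums generate the algebra of all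
    functions ([adjacency_connected]); multiplying along a path, every Y_ab is a
    product of functions F_m of one coordinate each ([ratio_coord_prod]).
    Dividing D Y_ab by Y_ab gives the sum over m of (sum of F_m) / F_m(x_m); as
    it is constant in x, each of its terms is constant, and that says that Y_ab
    is an eigenvector of L_m ([line_kernel_eigen]). *)

Set Implicit Arguments.
Unset Strict Implicit.
Unset Printing Implicit Defensive.

Import Order.TTheory GRing.Theory Num.Theory.
Local Open Scope ring_scope.

(** * Ratios of columns of a type II matrix *)

Section ColumnRatios.
Variables (K : fieldType) (X I : finType).

Definition ratio (W : X -> I -> K) (a b : I) (x : X) : K := W x a / W x b.

(** The orthogonality of the ratios of rows follows from that of the ratios of
    columns when W is square, by inverting a matrix; carrying both spares an
    identification of X with I. *)
Record typeII_fun (W : X -> I -> K) (N : K) : Prop := TypeIIFun {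
  typeII_neq0 : forall x a, W x a != 0;
  typeII_col : forall a b, \sum_x ratio W a b x = (a == b)%:R * N;
  typeII_row : forall x z, \sum_b W x b / W z b = (x == z)%:R * N;
  typeII_order : N != 0
}.

Variables (W : X -> I -> K) (N : K).
Hypothesis tW : typeII_fun W N.
Local Notation Y := (ratio W).

Lemma ratio_neq0 a b x : Y a b x != 0.
Proof. by rewrite mulf_neq0 ?invr_eq0 ?(typeII_neq0 tW). Qed.

Lemma ratio_mul a b c x : Y a b x * Y b c x = Y a c x.
Proof. by rewrite /ratio mulrA divfK ?(typeII_neq0 tW). Qed.

Lemma ratioxx a x : Y a a x = 1.
Proof. by rewrite /ratio divff ?(typeII_neq0 tW). Qed.

Lemma ratioV a b x : (Y a b x)^-1 = Y b a x.
Proof. by rewrite /ratio invf_div. Qed.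

Lemma ratio_delta r x t :
  \sum_c Y r c t * Y c r x = (x == t)%:R * N.
Proof.
under eq_bigr => c _.
  rewrite /ratio (_ : _ * _ = W t r / W x r * (W x c / W t c)); last by
    rewrite mulrACA [RHS]mulrACA; congr (_ * _); rewrite mulrC.
  over.
rewrite -mulr_sumr (typeII_row tW).
case: eqP => [->|_]; last by rewrite mul0r mulr0.
by rewrite divff ?mul1r ?(typeII_neq0 tW).
Qed.

(** By orthogonality, the coefficient of u along the column ratio Y_ab is its
    pairing with the inverse ratio Y_ba. *)
Lemma ratio_expand a u x :
  N * u x = \sum_b (\sum_z u z * Y b a z) * Y a b x.
Proof.
under eq_bigr => b _ do rewrite mulr_suml.
rewrite exchange_big /=.
under eq_bigr => z _.
  under eq_bigr => b _ do rewrite -mulrA [Y b a z * _]mulrC.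
  rewrite -mulr_sumr ratio_delta.
  over.
rewrite (bigD1 x) //= eqxx mul1r big1 ?addr0 1?mulrC // => z.
by rewrite eq_sym => /negPf zx; rewrite zx mul0r mulr0.
Qed.

(** Expanding the point mass at x along the Y_rc gives
    N k(z, x) = sum over c of th(r, c) Y_rc(z) Y_cr(x), for any r.  Taking for r
    the denominator of Y_pr makes the factors Y_rc(z) Y_pr(z) = Y_pc(z) sum to
    zero over z unless c = p. *)
Lemma eigenvalue_transpose (k : X -> X -> K) (th : I -> I -> K) :
  (forall a b x, \sum_z k x z * Y a b z = th a b * Y a b x) ->
  forall a b x, \sum_z k z x * Y a b z = th b a * Y a b x.
Proof.
move=> kP p r x; apply: (mulfI (typeII_order tW)); rewrite mulr_sumr.
have kE z : N * k z x = \sum_c th r c * Y r c z * Y c r x.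
  under eq_bigr => c _ do rewrite -kP mulr_suml.
  rewrite exchange_big /=.
  under eq_bigr => t _.
    under eq_bigr => c _ do rewrite -mulrA.
    rewrite -mulr_sumr ratio_delta.
    over.
  rewrite (bigD1 x) //= eqxx mul1r big1 ?addr0 1?mulrC // => t.
  by rewrite eq_sym => /negPf tx; rewrite tx mul0r mulr0.
under eq_bigr => z _ do rewrite mulrA kE mulr_suml.
rewrite exchange_big /=.
transitivity (\sum_c th r c * Y c r x * \sum_z Y p c z).
  apply: eq_bigr => c _; rewrite mulr_sumr; apply: eq_bigr => z _.
  by rewrite -(ratio_mul p r c z); ring.
rewrite (bigD1 p) //= (typeII_col tW) eqxx mul1r big1 ?addr0; first by ring.
by move=> c /negPf; rewrite (typeII_col tW) eq_sym => ->; rewrite mul0r mulr0.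
Qed.

End ColumnRatios.

(** * Coordinate sums and coordinate products *)

Section Words.
Variables (K : numFieldType) (J Q : finType).
Local Notation X := {ffun J -> Q}.
Implicit Types (x z : X) (y u v : X -> K).

Definition upd x k c : X := [ffun m => if m == k then c else x m].

Lemma upd_same x k c : upd x k c k = c.
Proof. by rewrite ffunE eqxx. Qed.

Lemma upd_other x k c m : m != k -> upd x k c m = x m.
Proof. by rewrite ffunE => /negPf ->. Qed.

Lemma upd_id x k : upd x k (x k) = x.
Proof. by apply/ffunP => m; rewrite ffunE; case: eqP => [->|]. Qed.

Lemma upd_upd x k c c' : upd (upd x k c) k c' = upd x k c'.
Proof. by apply/ffunP => m; rewrite !ffunE; case: eqP. Qed.

Definition coord_sum y :=
  exists f : J -> Q -> K, forall x, y x = \sum_k f k (x k).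
Definition coord_prod y :=
  exists f : J -> Q -> K, forall x, y x = \prod_k f k (x k).

Lemma coord_sum_upd (f : J -> Q -> K) x k c :
  \sum_m f m (upd x k c m) = \sum_m f m (x m) - f k (x k) + f k c.
Proof.
rewrite (bigD1 k) //= [X in _ = X - _ + _](bigD1 k) //= upd_same.
by rewrite (eq_bigr (fun m => f m (x m))) => [|m mk]; [ring | rewrite upd_other].
Qed.

Lemma sum_coord_prod (f : J -> Q -> K) :
  \sum_(x : X) \prod_k f k (x k) = \prod_k \sum_c f k c.
Proof. by rewrite bigA_distr_bigA. Qed.

Lemma coord_prod_single (x0 : X) y k :
  (forall x x', x k = x' k -> y x = y x') -> coord_prod y.
Proof.
move=> yP; exists (fun m c => if m == k then y (upd x0 k c) else 1) => x.
rewrite (bigD1 k) //= eqxx big1 ?mulr1 => [|m /negPf ->//].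
by apply: yP; rewrite upd_same.
Qed.

Lemma coord_prodM y u :
  coord_prod y -> coord_prod u -> coord_prod (fun x => y x * u x).
Proof.
move=> [f fP] [g gP]; exists (fun k c => f k c * g k c) => x.
by rewrite fP gP -big_split.
Qed.

(** Constancy of the squares says that F and G take two opposite values each,
    without choosing signs. *)
Definition two_coord y k l (F G : Q -> K) al be :=
  [/\ k != l, forall x, y x = F (x k) + G (x l),
      (forall t, F t ^+ 2 = al) /\ (forall t, G t ^+ 2 = be),
      exists s t, F s != F t & exists s t, G s != G t].

(** The hypotheses say that (p11, p22) and (p12, p21) have the same sum and the
    same sum of inverses.  If the sum is nonzero they also have the same
    product, hence coincide as unordered pairs, which the last two hypotheses
    exclude. *)
Lemma inv_sum_quad (p11 p12 p21 p22 : K) :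
  p11 != 0 -> p12 != 0 -> p21 != 0 -> p22 != 0 ->
  p11 + p22 = p12 + p21 -> p11^-1 + p22^-1 = p12^-1 + p21^-1 ->
  p11 != p21 -> p11 != p12 -> p11 + p22 = 0.
Proof.
move=> n11 n12 n21 n22 e1 e2 d1 d2.
have h (s t : K) : s != 0 -> t != 0 -> s^-1 + t^-1 = (s + t) / (s * t).
  by move=> s0 t0; field; rewrite s0 t0.
rewrite !h // -e1 in e2; apply/eqP; apply: contraT => s0.
move/(mulfI s0): e2 => /invr_inj e2.
have : (p11 - p12) * (p11 - p21) = 0.
  have -> : (p11 - p12) * (p11 - p21) = p11 * p11 - p11 * (p12 + p21) + p12 * p21
    by ring.
  by rewrite -e1 -e2; ring.
by move/eqP; rewrite mulf_eq0 !subr_eq0 (negPf d1) (negPf d2).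
Qed.

(** Changing coordinates k and l between c, c' and e, e' yields four values to
    which [inv_sum_quad] applies; the resulting relation determines y x from
    the coordinates k and l of x alone. *)
Lemma coord_sum_inv y (f : J -> Q -> K) :
  (forall x, y x != 0) -> (forall x, y x = \sum_k f k (x k)) ->
  coord_sum (fun x => (y x)^-1) ->
  forall k l c c' e e', k != l -> f k c != f k c' -> f l e != f l e' ->
  forall x, 2 * y x =
    2 * f k (x k) + 2 * f l (x l) - (f k c + f k c' + f l e + f l e').
Proof.
move=> yn0 yf [g yg] k l c c' e e' kl fk fl x.
have lk : l != k by rewrite eq_sym.
pose p a b := y (upd (upd x k a) l b).
have pf a b : p a b = y x - f k (x k) + f k a - f l (x l) + f l b.
  by rewrite /p yf coord_sum_upd upd_other // coord_sum_upd -yf.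
have pg a b : (p a b)^-1 = (y x)^-1 - g k (x k) + g k a - g l (x l) + g l b.
  by rewrite /p yg coord_sum_upd upd_other // coord_sum_upd -yg.
have : p c e + p c' e' = 0.
  apply: (@inv_sum_quad _ (p c e') (p c' e)); try exact: yn0.
  - by rewrite !pf; ring.
  - by rewrite !pg; ring.
  - by rewrite !pf -subr_eq0 (_ : _ - _ = f k c - f k c') ?subr_eq0; last by ring.
  - by rewrite !pf -subr_eq0 (_ : _ - _ = f l e - f l e') ?subr_eq0; last by ring.
rewrite !pf => h.
have -> : 2 * y x = 2 * y x - 0 by ring.
by rewrite -h; ring.
Qed.

Lemma sqr_const_of_pair (f : Q -> K) c c' :
  (forall t, f t != f c -> f t = f c') ->
  forall t, (f t - (f c + f c') / 2) ^+ 2 = ((f c - f c') / 2) ^+ 2.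
Proof.
move=> fP t; have [->|/fP ->] := eqVneq (f t) (f c); by field.
Qed.

(** If two of the summands vary, [coord_sum_inv] leaves only these two.  It also
    forces f k c + f k c' to be the same for all c, c' with f k c <> f k c', so
    that f k takes two values; subtracting their mean makes them opposite, and
    the means for k and l cancel. *)
Lemma coord_sum_inv_cases (k0 : J) (x0 : X) y :
  (forall x, y x != 0) -> coord_sum y -> coord_sum (fun x => (y x)^-1) ->
  coord_prod y \/ exists k l F G al be, two_coord y k l F G al be.
Proof.
move=> yn0 [f yf] yV; have H := coord_sum_inv yn0 yf yV.
pose nonc k := [exists c, exists c', f k c != f k c'].
have noncP k : ~~ nonc k -> forall c c', f k c = f k c'.
  by move/existsPn => h c c'; have /existsPn/(_ c')/negPn/eqP := h c.
case: (pickP nonc) => [k nk|none]; last first.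
  left; apply: (coord_prod_single x0 (k := k0)) => x x' _.
  by rewrite !yf; apply: eq_bigr => m _; apply: noncP; rewrite none.
case: (pickP (fun l => (k != l) && nonc l)) => [l /andP[kl nl]|none]; last first.
  left; apply: (coord_prod_single x0 (k := k)) => x x' e.
  rewrite !yf; apply: eq_bigr => m _; have := none m.
  by have [<-|_ /=] := eqVneq k m; [rewrite e | move/negbT/noncP].
right; have /existsP[c /existsP[c' cc]] := nk.
have /existsP[e /existsP[e' ee]] := nl.
have two0 : (2 : K) != 0 by rewrite pnatr_eq0.
exists k, l, (fun t => f k t - (f k c + f k c') / 2),
  (fun t => f l t - (f l e + f l e') / 2), (((f k c - f k c') / 2) ^+ 2),
  (((f l e - f l e') / 2) ^+ 2); split=> //.
- by move=> x; apply: (mulfI two0); rewrite (H _ _ _ _ _ _ kl cc ee); field.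
- have P := H _ _ _ _ _ _ kl cc ee x0.
  split; apply: sqr_const_of_pair => t; rewrite eq_sym => tc.
    have := H _ _ _ _ _ _ kl tc ee x0; rewrite P.
    by move/addrI/oppr_inj/addIr/addIr/addrI.
  have := H _ _ _ _ _ _ kl cc tc x0; rewrite P.
  by move/addrI/oppr_inj/addrI.
- by exists c, c'; apply: contra cc => /eqP/addIr/eqP.
- by exists e, e'; apply: contra ee => /eqP/addIr/eqP.
Qed.

End Words.

(** * Ratios that are eigenvectors of the agreement matrix *)

Section AgreementEigenvectors.
Variables (K : numFieldType) (J Q I : finType).
Local Notation X := {ffun J -> Q}.
Variables (W : X -> I -> K) (N : K).
Hypothesis tW : typeII_fun W N.
Local Notation Y := (ratio W).
Variables (k0 : J) (x0 : X).
Variable th : I -> I -> K.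
Hypothesis thP : forall a b (x : X),
  \sum_(z : X) (\sum_k (x k == z k)%:R) * Y a b z = th a b * Y a b x.

Definition fibre_sum (y : X -> K) k c := \sum_(z : X | z k == c) y z.

Lemma agreement_fibre_sums (y : X -> K) (x : X) :
  \sum_(z : X) (\sum_k (x k == z k)%:R) * y z = \sum_k fibre_sum y k (x k).
Proof.
under eq_bigr => z _ do rewrite mulr_suml.
rewrite exchange_big /=; apply: eq_bigr => k _.
rewrite /fibre_sum [RHS]big_mkcond; apply: eq_bigr => z _.
by rewrite eq_sym; case: eqP; rewrite ?mul1r ?mul0r.
Qed.

Lemma fibre_sumE a b (x : X) :
  \sum_k fibre_sum (Y a b) k (x k) = th a b * Y a b x.
Proof. by rewrite -agreement_fibre_sums thP. Qed.

Lemma th_sym a b : th a b = th b a.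
Proof.
have h := eigenvalue_transpose tW thP a b x0.
apply: (mulIf (ratio_neq0 tW a b x0)); rewrite -h -thP.
apply: eq_bigr => z _; congr (_ * _); apply: eq_bigr => k _.
by rewrite eq_sym.
Qed.

Lemma th_refl a : th a a != 0.
Proof.
have := fibre_sumE a a x0; rewrite (ratioxx tW) mulr1 => <-.
rewrite psumr_neq0; last first.
  by move=> k _; apply: sumr_ge0 => z _; rewrite (ratioxx tW) ler01.
apply/hasP; exists k0; first exact: mem_index_enum.
rewrite /= /fibre_sum (bigD1 x0) //= (ratioxx tW) ltr_wpDr ?ltr01 //.
by apply: sumr_ge0 => z _; rewrite (ratioxx tW) ler01.
Qed.

Lemma ratio_coord_sum a b : th a b != 0 -> coord_sum (Y a b).
Proof.
move=> t0; exists (fun k c => (th a b)^-1 * fibre_sum (Y a b) k c) => x.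
by rewrite -mulr_sumr fibre_sumE mulrA mulVf ?mul1r.
Qed.

(** The fibre sums over coordinate k do not depend on c, because S annihilates
    Y_ab; they add up to the sum of Y_ab, which is zero for a <> b. *)
Lemma ratio_fibre_sum0 a b k c : th a b = 0 -> fibre_sum (Y a b) k c = 0.
Proof.
move=> t0; have ab : a != b by apply: contra_eq_neq t0 => <-; exact: th_refl.
have s0 (x : X) : \sum_k fibre_sum (Y a b) k (x k) = 0.
  by rewrite fibre_sumE t0 mul0r.
have cst c' : fibre_sum (Y a b) k c' = fibre_sum (Y a b) k c.
  have := s0 (upd x0 k c'); rewrite coord_sum_upd s0 => /eqP.
  have := s0 (upd x0 k c); rewrite coord_sum_upd s0 => /eqP.
  by rewrite !sub0r ![- _ + _]addrC !subr_eq0 => /eqP -> /eqP.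
have : \sum_c' fibre_sum (Y a b) k c' = 0.
  transitivity (\sum_z Y a b z); last by rewrite (typeII_col tW) (negPf ab) mul0r.
  by rewrite (partition_big (fun z : X => z k) predT).
rewrite (eq_bigr (fun=> fibre_sum (Y a b) k c)) => [|c' _]; last exact: cst.
rewrite sumr_const => /eqP.
rewrite -mulr_natr mulf_eq0 pnatr_eq0 => /orP[/eqP//|].
by move/eqP/card0_eq/(_ c).
Qed.

Lemma sum_fibre (y : X -> K) (f : J -> Q -> K) :
  (forall x : X, y x = \sum_k f k (x k)) -> forall u,
  \sum_x y x * u x = \sum_k \sum_c f k c * fibre_sum u k c.
Proof.
move=> yf u; under eq_bigr => x _ do rewrite yf mulr_suml.
rewrite exchange_big; apply: eq_bigr => k _.
rewrite (partition_big (fun z : X => z k) predT) //=; apply: eq_bigr => c _.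
by rewrite mulr_sumr; apply: eq_bigr => x /eqP ->.
Qed.

(** Together with [ratio_expand]: a coordinate sum is a combination of the Y_ab
    with b adjacent to a. *)
Lemma coord_sum_expand a u : coord_sum u ->
  forall b, th a b = 0 -> \sum_z u z * Y b a z = 0.
Proof.
move=> [f uf] b t0; rewrite (sum_fibre uf) big1 // => k _; rewrite big1 // => c _.
by rewrite ratio_fibre_sum0 ?mulr0 // th_sym.
Qed.

(** * Adjacent columns differ in one coordinate *)

Section Exclusion.
Hypothesis Q_gt2 : (2 < #|Q|)%N.

Lemma fibre_sum_upd (v : X -> K) k e e' :
  fibre_sum v k e = \sum_(x : X | x k == e') v (upd x k e).
Proof.
rewrite /fibre_sum (reindex_onto (fun x : X => upd x k e) (fun x => upd x k e')) /=.
  apply: eq_bigl => x; rewrite upd_same eqxx /= upd_upd.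
  by apply/eqP/eqP => <-; rewrite ?upd_same ?upd_id.
by move=> x /eqP <-; rewrite upd_upd upd_id.
Qed.

(** Here Y_ab = F(x_k) + G(x_l), hence Y_ba = (F(x_k) - G(x_l)) / (al - be), and
    both have zero sum, so that G has zero sum.  Let F e = F e' and let
    v = Y_ac = h_1(x_1) + ... with c adjacent to a, so that Y_bc = Y_ba v.
    If b, c are not adjacent, the difference of the fibre sums of Y_bc at e and
    e' is a nonzero multiple of h_k(e) - h_k(e').  If they are adjacent, the
    mixed difference of Y_bc over e, e' at k and s', t' at l vanishes, and it is
    (h_k(e) - h_k(e')) (G t' - G s') / (al - be).  Either way
    h_k(e) = h_k(e'). *)
Lemma two_coord_false a b k l F G al be :
  th a b != 0 -> two_coord (Y a b) k l F G al be -> False.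
Proof.
move=> tab [kl uE [F2 G2] [s [t Fst]] [s' [t' Gst]]].
have lk : l != k by rewrite eq_sym.
have anti (H : Q -> K) ga p p' :
    (forall t, H t ^+ 2 = ga) -> H p != H p' -> H p = - H p'.
  move=> h d; apply/eqP; rewrite -addr_eq0; apply: contraT => n.
  have: (H p - H p') * (H p + H p') = 0 by rewrite -subr_sqr !h subrr.
  by move/eqP; rewrite mulf_eq0 subr_eq0 (negPf d) (negPf n).
have F0 e : F e != 0.
  apply: contra Fst => /eqP Fe.
  have z p : F p = 0 by apply/eqP; rewrite -sqrf_eq0 F2 -(F2 e) Fe expr0n.
  by rewrite !z.
(* -F e is also a value of F, and Y_ab has no zero. *)
have FGn0 e e' : F e - G e' != 0.
  have [p Fp] : exists p, F p = - F e.
    have [es|es] := eqVneq (F e) (F s).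
      by exists t; rewrite es (anti _ _ _ _ F2 Fst) opprK.
    by exists s; rewrite (anti _ _ _ _ F2 es) opprK.
  have := ratio_neq0 tW a b (upd (upd x0 k p) l e').
  rewrite uE upd_same upd_other // upd_same Fp.
  by rewrite -oppr_eq0 opprD opprK.
have d0 : al - be != 0.
  by rewrite -(F2 s) -(G2 s) subr_sqr mulf_neq0 //; have := ratio_neq0 tW a b
    (upd (upd x0 k s) l s); rewrite uE upd_same upd_other // upd_same.
have vE x : Y b a x = (F (x k) - G (x l)) / (al - be).
  rewrite -ratioV uE -(F2 (x k)) -(G2 (x l)) subr_sqr; field.
  by rewrite FGn0 -uE (ratio_neq0 tW).
have ab : a != b.
  apply/eqP => ab; move: Fst; rewrite -ab in uE.
  have h p : F p = 1 - G s.
    have := uE (upd (upd x0 k p) l s).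
    by rewrite (ratioxx tW) upd_same upd_other // upd_same => ->; rewrite addrK.
  by rewrite !h eqxx.
have sumG : \sum_x G ((x : X) l) = 0.
  have := typeII_col tW b a; rewrite eq_sym (negPf ab) mul0r.
  under eq_bigr => x _ do rewrite vE.
  rewrite -mulr_suml => /eqP; rewrite mulf_eq0 invr_eq0 (negPf d0) orbF => /eqP.
  have := typeII_col tW a b; rewrite (negPf ab) mul0r.
  under eq_bigr => x _ do rewrite uE.
  rewrite big_split sumrB /= => h1 h2.
  move/eqP: h2; rewrite subr_eq0 => /eqP e; move: h1.
  by rewrite e -mulr2n => /eqP; rewrite mulrn_eq0 => /eqP.
have fibG e : fibre_sum (fun x => G (x l)) k e = 0.
  have cst e' :
      fibre_sum (fun x => G (x l)) k e' = fibre_sum (fun x => G (x l)) k e.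
    by rewrite (fibre_sum_upd _ _ _ e); apply: eq_bigr => x _; rewrite upd_other.
  move: sumG; rewrite (partition_big (fun z : X => z k) predT) //=.
  rewrite (eq_bigr (fun=> fibre_sum (fun x => G (x l)) k e)); last first.
    by move=> c' _; apply: cst.
  rewrite sumr_const => /eqP.
  rewrite -mulr_natr mulf_eq0 pnatr_eq0 => /orP[/eqP//|].
  by move/eqP/card0_eq/(_ e).
have insens c e e' : th a c != 0 -> F e = F e' ->
    Y a c (upd x0 k e) = Y a c (upd x0 k e').
  move=> tac Fe; have [h vf] := ratio_coord_sum tac.
  suff he : h k e = h k e' by rewrite !vf !coord_sum_upd he.
  apply/eqP; rewrite -subr_eq0; apply: contraT => hn.
  have wE x : Y b c x = (F (x k) - G (x l)) / (al - be) * Y a c x.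
    by rewrite -vE (ratio_mul tW).
  have [tbc|tbc] := eqVneq (th b c) 0.
    have := ratio_fibre_sum0 k e tbc; rewrite (fibre_sum_upd _ _ _ e').
    rewrite -[RHS](ratio_fibre_sum0 k e' tbc) => /eqP.
    rewrite -subr_eq0 -sumrB.
    rewrite (eq_bigr (fun x : X =>
      (h k e - h k e') / (al - be) * (F e' - G (x l)))).
      rewrite -mulr_sumr sumrB (fibG e' : \sum_(x : X | x k == e') _ = 0) subr0.
      rewrite sumr_const -mulr_natr.
      rewrite !mulf_eq0 (negPf hn) invr_eq0 (negPf d0) (negPf (F0 _)) /= pnatr_eq0.
      move/eqP/card0_eq/(_ (upd x0 k e')).
      by move=> /idP[]; apply/eqP/upd_same.
    move=> x /eqP xk; rewrite !wE upd_same upd_other // vf coord_sum_upd -vf xk Fe.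
    by ring.
  have [w wf] := ratio_coord_sum tbc.
  pose P p j := upd (upd x0 k p) l j.
  have w2 : Y b c (P e s') - Y b c (P e' s') - Y b c (P e t') + Y b c (P e' t') = 0.
    by rewrite !wf /P !coord_sum_upd !(upd_other _ _ lk); ring.
  move: w2; rewrite !wE /P !upd_same !(upd_other _ _ kl) !upd_same.
  rewrite !vf !coord_sum_upd !(upd_other _ _ lk) Fe.
  set r := \sum_k _ => w2.
  have : (h k e - h k e') * (G t' - G s') / (al - be) = 0 by rewrite -w2; ring.
  move/eqP; rewrite !mulf_eq0 (negPf hn) invr_eq0 (negPf d0) subr_eq0 eq_sym.
  by rewrite (negPf Gst).
(* F takes two values on at least three letters. *)
have [e [e' [ee Fe]]] : exists e e', e != e' /\ F e = F e'.
  have /card_gt0P[c] : (0 < #|[predC [:: s; t]]|)%N.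
    rewrite -(ltn_add2l #|[:: s; t]|) addn0 cardC (leq_ltn_trans _ Q_gt2) //.
    exact: card_size.
  rewrite !inE negb_or => /andP[cs ct].
  have [Fc|Fc] := eqVneq (F c) (F s); first by exists c, s.
  exists c, t; split=> //; rewrite (anti _ _ _ _ F2 Fc).
  by rewrite (anti _ _ _ _ F2 Fst) opprK.
pose ind (x : X) : K := (x k == e)%:R.
have indS : coord_sum ind.
  exists (fun m c => if m == k then (c == e)%:R else 0) => x.
  by rewrite (bigD1 k) //= eqxx big1 ?addr0 // => m /negPf ->.
have : N * ind (upd x0 k e) = N * ind (upd x0 k e').
  rewrite !(ratio_expand tW a); apply: eq_bigr => c _.
  have [tac|tac] := eqVneq (th a c) 0; last by rewrite (insens c e e').
  by rewrite (coord_sum_expand indS tac) !mul0r.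
move/(mulfI (typeII_order tW)); rewrite /ind !upd_same eqxx eq_sym (negPf ee).
by move/eqP; rewrite oner_eq0.
Qed.

Lemma ratio_coord_prod_adj a b : th a b != 0 -> coord_prod (Y a b).
Proof.
move=> tab; have tba : th b a != 0 by rewrite th_sym.
have [|//|[k [l [F [G [al [be]]]]]]] :=
    coord_sum_inv_cases k0 x0 (ratio_neq0 tW a b) (ratio_coord_sum tab).
  have [g gE] := ratio_coord_sum tba.
  by exists g => x; rewrite ratioV gE.
by move/(two_coord_false tab).
Qed.

(** * Connectedness of adjacency *)

(** The functions without component along the Y_ab with b outside S contain 1
    and are stable under multiplication by coordinate sums, as
    Y_ab * Y_bc = Y_ac.  Hence they contain the point mass at x0, which is a
    product of indicators of coordinates; but no Y_ba vanishes at x0. *)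
Lemma adjacency_connected a (S : pred I) :
  S a -> (forall b c, S b -> th b c != 0 -> S c) -> forall b, S b.
Proof.
move=> Sa Scl b; apply: contraT => nSb.
pose inside (u : X -> K) := forall p, ~~ S p -> \sum_z u z * Y p a z = 0.
have insideM u g : inside u -> coord_sum g -> inside (fun x => u x * g x).
  move=> uS gS p nSp; apply: (mulfI (typeII_order tW)).
  apply: (mulfI (typeII_order tW)); rewrite !mulr0 mulr_sumr mulr_sumr.
  rewrite (eq_bigr (fun z => \sum_b' \sum_c (\sum_z u z * Y b' a z) *
      ((\sum_z g z * Y c b' z) * (Y a c z * Y p a z)))); last first.
    move=> z _; transitivity ((N * u z) * (N * g z) * Y p a z); first by ring.
    rewrite (ratio_expand tW a u) !mulr_suml; apply: eq_bigr => b' _.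
    rewrite (ratio_expand tW b' g) mulr_sumr mulr_suml; apply: eq_bigr => c _.
    by rewrite -(ratio_mul tW a b' c); ring.
  rewrite exchange_big big1 // => b' _; rewrite exchange_big big1 // => c _ /=.
  have [Sb|nSb'] := boolP (S b'); last first.
    by rewrite big1 // => z _; rewrite uS // mul0r.
  have [tbc|tbc] := eqVneq (th b' c) 0.
    by rewrite big1 // => z _; rewrite (coord_sum_expand gS tbc) mul0r mulr0.
  have Sc := Scl _ _ Sb tbc.
  have orth : \sum_z Y a c z * Y p a z = 0.
    under eq_bigr => z _ do rewrite mulrC (ratio_mul tW).
    rewrite (typeII_col tW) (_ : (p == c) = false) ?mul0r //.
    by apply: contraNF nSp => /eqP ->.
  by rewrite -!mulr_sumr orth !mulr0.
have inside1 : inside (fun=> 1).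
  move=> p nSp; under eq_bigr => z _ do rewrite mul1r.
  rewrite (typeII_col tW) (_ : (p == a) = false) ?mul0r //.
  by apply: contraNF nSp => /eqP ->.
have inside_prod (r : seq J) :
    inside (fun x => \prod_(k <- r) (x k == x0 k)%:R).
  elim: r => [|k r IHr] p nSp.
    by under eq_bigr => z _ do rewrite big_nil; apply: inside1.
  under eq_bigr => z _ do rewrite big_cons [_%:R * _]mulrC.
  apply: (insideM _ (fun x : X => (x k == x0 k)%:R)) => //.
  exists (fun m c => if m == k then (c == x0 k)%:R else 0) => x.
  by rewrite (bigD1 k) //= eqxx big1 ?addr0 // => m /negPf ->.
have := inside_prod (index_enum J) b nSb.
rewrite (bigD1 x0) //= big1 => [|k _]; last by rewrite eqxx.
rewrite mul1r big1 ?addr0 => [/eqP|z zx0].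
  by rewrite (negPf (ratio_neq0 tW _ _ _)).
have [k zk] : exists k, z k != x0 k.
  apply/existsP; apply: contraNT zx0 => /existsPn h; apply/eqP/ffunP => k.
  by have /negPn/eqP := h k.
by rewrite (bigD1 k) //= (negPf zk) !mul0r.
Qed.

Lemma ratio_coord_prod a b : coord_prod (Y a b).
Proof.
apply: asboolW.
apply: (@adjacency_connected a (fun c => `[< coord_prod (Y a c) >])).
  by apply/asboolP; exists (fun _ _ => 1) => x; rewrite (ratioxx tW) big1.
move=> c e /asboolP pc /ratio_coord_prod_adj pe; apply/asboolP.
have [f fE] := coord_prodM pc pe.
by exists f => x; rewrite -fE (ratio_mul tW).
Qed.

(** * Eigenvectors of the lines in one direction *)

Section Lines.
Variable mu : I -> I -> K.
Definition line_kernel k (x z : X) : K := \prod_(m | m != k) (x m == z m)%:R.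
Hypothesis muP : forall a b (x : X),
  \sum_(z : X) (\sum_k line_kernel k x z) * Y a b z = mu a b * Y a b x.

Lemma line_kernel_prod k (x : X) (f : J -> Q -> K) :
  \sum_(z : X) line_kernel k x z * \prod_m f m (z m) =
  (\sum_c f k c) * \prod_(m | m != k) f m (x m).
Proof.
transitivity (\sum_(z : X) \prod_m
    ((if m == k then 1 else (x m == z m)%:R) * f m (z m))).
  apply: eq_bigr => z _; rewrite big_split /=; congr (_ * _).
  rewrite (bigD1 k) //= eqxx mul1r.
  by apply: eq_bigr => m /negPf ->.
rewrite (sum_coord_prod
  (fun m c => (if m == k then 1 else (x m == c)%:R) * f m c)).
rewrite (bigD1 k) //= eqxx; congr (_ * _).
  by apply: eq_bigr => c _; rewrite mul1r.
apply: eq_bigr => m /negPf ->; rewrite (bigD1 (x m)) //= eqxx mul1r big1 ?addr0 //.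
by move=> c; rewrite eq_sym => /negPf ->; rewrite mul0r.
Qed.

(** For a coordinate product, L_m multiplies Y_ab by (sum of f_m) / f_m(x_m).
    The sum of these factors over m is constant, and its m-th term involves x_m
    only, so it is constant too. *)
Lemma line_kernel_eigen a b k :
  exists ka, forall x, \sum_(z : X) line_kernel k x z * Y a b z = ka * Y a b x.
Proof.
have [f fE] := ratio_coord_prod a b.
have fn0 (x : X) m : f m (x m) != 0.
  have := ratio_neq0 tW a b x; rewrite fE.
  by apply: contra => /eqP h; rewrite (bigD1 m) //= h mul0r.
have LE (x : X) m : \sum_(z : X) line_kernel m x z * Y a b z =
    (\sum_c f m c) / f m (x m) * Y a b x.
  under eq_bigr => z _ do rewrite fE.
  by rewrite line_kernel_prod fE [in RHS](bigD1 m) //= mulrA divfK.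
have sumE (x : X) : \sum_m (\sum_c f m c) / f m (x m) = mu a b.
  apply: (mulIf (ratio_neq0 tW a b x)); rewrite -muP mulr_suml.
  under [RHS]eq_bigr => z _ do rewrite mulr_suml.
  by rewrite exchange_big; apply: eq_bigr => m _; rewrite -LE.
exists ((\sum_c f k c) / f k (x0 k)) => x; rewrite LE; congr (_ * _).
have := sumE (upd x0 k (x k)).
rewrite (coord_sum_upd (fun m c => (\sum_d f m d) / f m c)) sumE => h.
by apply: (@addrI _ (mu a b - (\sum_c f k c) / f k (x0 k))); rewrite h subrK.
Qed.
End Lines.
End Exclusion.
End AgreementEigenvectors.

(** * Members of the Bose-Mesner algebra of H(n, A) *)

Section BoseMesnerMembership.
Variables (K : fieldType) (q d n : nat) (A : 'I_d.+1 -> 'M[K]_q).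

Lemma kron_sum (c : 'I_n -> 'I_d.+1 -> K) :
  kron (fun k => \sum_i c k i *: A i) =
  \sum_(i : {ffun 'I_n -> 'I_d.+1}) (\prod_k c k (i k)) *: prod_scheme A i.
Proof.
apply/matrixP => x y; rewrite kronE summxE.
under eq_bigr => k _ do rewrite summxE.
rewrite bigA_distr_bigA; apply: eq_bigr => i _.
rewrite mxE kronE -big_split; apply: eq_bigr => k _.
by rewrite mxE.
Qed.

Lemma kron_sum_mem (c : 'I_n -> 'I_d.+1 -> K) :
  kron (fun k => \sum_i c k i *: A i) \in mxspan (prod_scheme (n := n) A).
Proof.
rewrite kron_sum; apply: rpred_sum => i _; apply: rpredZ; apply: memv_span.
exact: image_f.
Qed.

Lemma tensor_action_kron (c : 'I_n -> 'I_d.+1 -> K) (s : 'S_n) f :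
  is_tensor_action A s f ->
  f (kron (fun k => \sum_i c k i *: A i)) =
  kron (fun k => \sum_i c ((s^-1)%g k) i *: A i).
Proof.
move=> fP; rewrite !kron_sum linear_sum.
pose h (t : 'S_n) (i : {ffun 'I_n -> 'I_d.+1}) := [ffun k => i (t k)].
have hK : cancel (h s) (h (s^-1)%g).
  by move=> i; apply/ffunP => k; rewrite !ffunE permKV.
rewrite [LHS](reindex_inj (can_inj hK)); apply: eq_bigr => i _.
rewrite linearZ /= fP; congr (_ *: prod_scheme A _); last first.
  by apply/ffunP => k; rewrite !ffunE permKV.
rewrite [RHS](reindex_inj (@perm_inj _ s)); apply: eq_bigr => k _.
by rewrite permK ffunE.
Qed.

Lemma sum_if_scale (b : bool) (c1 c2 : 'I_d.+1 -> K) :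
  \sum_i (if b then c1 i else c2 i) *: A i =
  if b then \sum_i c1 i *: A i else \sum_i c2 i *: A i.
Proof. by case: b. Qed.

Definition kron_single (U V : 'M[K]_q) (k : 'I_n) : 'M[K]_(q ^ n) :=
  kron (fun l => if l == k then U else V).

Section Single.
Variables (U V : 'M[K]_q) (cU cV : 'I_d.+1 -> K).
Hypotheses (UE : U = \sum_i cU i *: A i) (VE : V = \sum_i cV i *: A i).

Lemma kron_single_coef k :
  kron_single U V k =
  kron (fun l => \sum_i (if l == k then cU i else cV i) *: A i).
Proof.
by congr kron; apply: funext => l; rewrite UE VE sum_if_scale.
Qed.

Lemma tensor_action_single (s : 'S_n) f k :
  is_tensor_action A s f -> f (kron_single U V k) = kron_single U V (s k).
Proof.
move=> fP; rewrite kron_single_coef.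
rewrite (tensor_action_kron (fun l i => if l == k then cU i else cV i) fP).
rewrite kron_single_coef; congr kron; apply: funext => l.
by apply: eq_bigr => i _; rewrite (can2_eq (permKV s) (permK s)).
Qed.

Lemma sum_kron_single_BM : gen_hamming_BM A (\sum_k kron_single U V k).
Proof.
split=> [|s f fP].
  by apply: rpred_sum => k _; rewrite kron_single_coef; apply: kron_sum_mem.
rewrite linear_sum [RHS](reindex_inj (@perm_inj _ s)).
by apply: eq_bigr => k _; apply: tensor_action_single.
Qed.
End Single.

Hypothesis AP : is_assoc_scheme A.
Local Notation J1 := (const_mx 1 : 'M[K]_q).

Lemma scheme_one_coef : 1%:M = \sum_i (i == ord0)%:R *: A i.
Proof.
rewrite (bigD1 ord0) //= scale1r (scheme_id AP) big1 ?addr0 // => i /negPf ->.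
by rewrite scale0r.
Qed.

Lemma scheme_all_ones_coef : J1 = \sum_i 1 *: A i.
Proof. by rewrite -(scheme_sum AP); apply: eq_bigr => i _; rewrite scale1r. Qed.

Lemma agreement_BM : gen_hamming_BM A (\sum_k kron_single 1%:M J1 k).
Proof. exact: sum_kron_single_BM scheme_one_coef scheme_all_ones_coef. Qed.

Lemma lines_BM : gen_hamming_BM A (\sum_k kron_single J1 1%:M k).
Proof. exact: sum_kron_single_BM scheme_all_ones_coef scheme_one_coef. Qed.

(** The transposition of k0 and k1 turns the lines in direction k0 into those in
    direction k1, and two words that differ exactly at k0 tell them apart. *)
Lemma kron_single_line_not_BM (k0 k1 : 'I_n) :
  k0 != k1 -> (1 < q)%N -> ~ gen_hamming_BM A (kron_single J1 1%:M k0).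
Proof.
move=> k01 q1 [_]; have [f fP] := tensor_action_ex A (tperm k0 k1).
move/(_ _ _ fP).
rewrite (tensor_action_single scheme_all_ones_coef scheme_one_coef _ fP) tpermL.
move/matrixP => E.
have [x xP] := digit_surj (fun _ : 'I_n => Ordinal (ltnW q1)).
have [y yP] := digit_surj
  (fun k : 'I_n => if k == k0 then Ordinal q1 else Ordinal (ltnW q1)).
move: (E x y); rewrite !kronE (bigD1 k0) //= (negPf k01) mxE xP yP eqxx /= mul0r.
rewrite big1 => [/eqP|k _]; first by rewrite eq_sym oner_eq0.
case: eqP => kk; rewrite mxE // xP yP.
by rewrite (negPf (introN eqP kk)) eqxx.
Qed.

End BoseMesnerMembership.

(** * From words to matrix indices *)

Lemma digit_bij (q n : nat) :
  bijective (fun x : 'I_(q ^ n) => [ffun k => digit x k]).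
Proof.
apply: inj_card_bij => [x y /ffunP e|]; last by rewrite card_ffun !card_ord.
by apply: digit_inj => k; have := e k; rewrite !ffunE.
Qed.

Lemma typeII_mx_fun (K : numFieldType) (X : finType) (v : nat) (W : 'M[K]_v)
    (g : X -> 'I_v) :
  (0 < v)%N -> is_typeII W -> bijective g ->
  typeII_fun (fun x a => W (g x) a) v%:R.
Proof.
move=> v0 [W0 Wcol] gbij; split=> [x a|a b|x z|]; first exact: W0.
- rewrite -Wcol [RHS](reindex g) //; exact: onW_bij.
- have v1 : (v%:R : K) != 0 by rewrite pnatr_eq0 -lt0n.
  pose V : 'M[K]_v := \matrix_(b, i) (v%:R^-1 * (W i b)^-1).
  have VW : V *m W = 1%:M.
    apply/matrixP => b a; rewrite !mxE.
    transitivity (v%:R^-1 * \sum_i W i a / W i b).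
      rewrite mulr_sumr; apply: eq_bigr => i _.
      by rewrite mxE -mulrA [_^-1 * W _ _]mulrC.
    by rewrite Wcol eq_sym mulrCA mulVf ?mulr1.
  have := mulmx1C VW => /matrixP/(_ (g x) (g z)); rewrite !mxE => e.
  rewrite -(bij_eq gbij) -e mulr_suml; apply: eq_bigr => b _.
  by rewrite mxE mulrCA mulrAC mulrA mulVf ?mul1r // mulrC.
- by rewrite pnatr_eq0 -lt0n.
Qed.

Theorem theorem5p5 (R : realType) (q d : nat) (A : 'I_d.+1 -> 'M[R[i]]_q) :
  is_assoc_scheme A -> (3 <= q)%N ->
  forall n : nat, (2 <= n)%N ->
  ~ exists W : 'M[R[i]]_(q ^ n),
      is_typeII W /\ (forall M : 'M[R[i]]_(q ^ n), nomura W M <-> gen_hamming_BM A M).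
Proof.
move=> AP q3 n n2 [W [tW NW]].
have q0 : (0 < q)%N by apply: leq_trans q3.
have [word wordK dgK] := digit_bij q n.
have digitE (x : {ffun 'I_n -> 'I_q}) k : digit (word x) k = x k.
  by rewrite -[in RHS](dgK x) ffunE.
have wbij : bijective word by exists (fun x => [ffun k => digit x k]).
pose Ww (x : {ffun 'I_n -> 'I_q}) a := W (word x) a.
have tF : typeII_fun Ww (q ^ n)%:R.
  by apply: typeII_mx_fun; rewrite // expn_gt0 q0.
have eig M : gen_hamming_BM A M -> exists th : 'I_(q ^ n) -> 'I_(q ^ n) -> R[i],
    forall a b x, \sum_z M (word x) (word z) * ratio Ww a b z
      = th a b * ratio Ww a b x.
  move/NW => MN.
  pose P a b c := M *m nomura_vec W a b = c *: nomura_vec W a b.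
  have ex a : exists c, forall b, P a b (c b).
    by apply: fin_all_exists => b; have [_] := MN a b.
  have [th thP] := fin_all_exists ex.
  exists th => a b x; have /matrixP/(_ (word x) ord0) := thP a b.
  rewrite !mxE => <-; rewrite [RHS](reindex word); last exact: onW_bij.
  by apply: eq_bigr => z _; rewrite !mxE.
have kernelS k x z :
    kron_single 1%:M (const_mx 1 : 'M[R[i]]_q) k (word x) (word z) =
    (x k == z k)%:R.
  rewrite /kron_single kronE (bigD1 k) //= big1 => [|m /negPf mk].
    by rewrite eqxx mxE !digitE mulr1.
  by rewrite mk mxE.
have kernelL k x z :
    kron_single (const_mx 1 : 'M[R[i]]_q) 1%:M k (word x) (word z) =
    line_kernel R[i] k x z.
  rewrite /kron_single kronE (bigD1 k) //= eqxx mxE mul1r.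
  by apply: eq_bigr => m /negPf mk; rewrite mk mxE !digitE.
have [th thP] := eig _ (agreement_BM n AP).
have [mu muP] := eig _ (lines_BM n AP).
pose x0 : {ffun 'I_n -> 'I_q} := [ffun=> Ordinal q0].
pose k0 := Ordinal (ltnW n2); pose k1 := Ordinal n2.
have k01 : k0 != k1 by [].
apply: (kron_single_line_not_BM AP k01 (ltnW q3)); apply/NW => a b; split.
  apply/eqP => /matrixP/(_ (word x0) ord0) /eqP.
  by rewrite !mxE (negPf (ratio_neq0 tF a b _)).
have Q3 : (2 < #|'I_q|)%N by rewrite card_ord.
have thW c e (x : {ffun 'I_n -> 'I_q}) :
    \sum_(z : {ffun 'I_n -> 'I_q}) (\sum_k (x k == z k)%:R) * ratio Ww c e z =
    th c e * ratio Ww c e x.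
  rewrite -thP; apply: eq_bigr => z _; congr (_ * _); rewrite summxE.
  by apply: eq_bigr => k _; rewrite kernelS.
have muW c e x :
    \sum_z (\sum_k line_kernel R[i] k x z) * ratio Ww c e z =
    mu c e * ratio Ww c e x.
  rewrite -muP; apply: eq_bigr => z _; congr (_ * _); rewrite summxE.
  by apply: eq_bigr => k _; rewrite kernelL.
have [ka kaP] := line_kernel_eigen tF k0 x0 thW Q3 muW a b k0.
exists ka; apply/matrixP => x j; rewrite !mxE.
have := kaP [ffun k => digit x k]; rewrite /ratio /Ww wordK => <-.
rewrite (reindex word); last exact: onW_bij.
by apply: eq_bigr => z _; rewrite mxE -kernelL wordK.
Qed.
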